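(* Let $f$ be a Boolean function. Then all lower covers of $f$ have the same essential arity, and this common essential arity is either $\operatorname{ess} f-1$ or $\operatorname{ess} f-2$. If it equals $\operatorname{ess} f-2$, then $f$ is join-irreducible.
   Context: A Boolean function of arity $n\ge 1$ is a map $f\colon\{0,1\}^n\to\{0,1\}$. For $g$ of arity $m$ and $f$ of arity $n$, $g$ is a simple minor of $f$, written $g\le f$, if there is a map $\sigma\colon\{1,\dots,n\}\to\{1,\dots,m\}$ with $g(a_1,\dots,a_m)=f(a_{\sigma(1)},\dots,a_{\sigma(n)})$ for all $a_1,\dots,a_m\in\{0,1\}$. This is a quasi-order on the set of all Boolean functions; write $f\equiv g$ if $f\le g$ and $g\le f$, and $g<f$ if $g\le f$ but $f\not\le g$. The equivalence classes are partially ordered by $\tilde g\sqsubseteq\tilde f$ iff $g\le f$. A function $g$ is a lower cover of $f$ if $\tilde g$ is a lower cover of $\tilde f$ in this poset (i.e. $g<f$ and there is no $h$ with $g<h<f$). The variable $x_i$ is essential in $f$ if there are values of the other arguments for which $x\mapsto f(a_1,\dots,a_{i-1},x,a_{i+1},\dots,a_n)$ is nonconstant; $\operatorname{ess} f$ is the number of essential variables of $f$. The function $f$ is join-irreducible if there is $f'$ with $f'<f$ such that every $g<f$ satisfies $g\le f'$ (equivalently, $\tilde f$ has exactly one lower cover). *)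

(* Defs.v *)
From mathcomp Require Import all_boot.

Set Implicit Arguments.
Unset Strict Implicit.
Unset Printing Implicit Defensive.

Record boolfun := BoolFun {
  arity : nat;
  arity_gt0 : 0 < arity;
  bf_val :> {ffun arity.-tuple bool -> bool}
}.

Definition minor (g f : boolfun) : Prop :=
  exists sigma : 'I_(arity f) -> 'I_(arity g),
    forall a : (arity g).-tuple bool,
      g a = f [tuple tnth a (sigma i) | i < arity f].

Definition strict_minor (g f : boolfun) : Prop := minor g f /\ ~ minor f g.

Definition lower_cover (g f : boolfun) : Prop :=
  strict_minor g f /\
  ~ (exists h : boolfun, strict_minor g h /\ strict_minor h f).

Definition upd n (a : n.-tuple bool) (i : 'I_n) (x : bool) : n.-tuple bool :=
  [tuple if j == i then x else tnth a j | j < n].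

Definition essential (f : boolfun) (i : 'I_(arity f)) : bool :=
  [exists a : (arity f).-tuple bool, exists x : bool, exists y : bool,
     f (upd a i x) != f (upd a i y)].

Definition ess (f : boolfun) : nat := #|[set i | @essential f i]|.

Definition join_irreducible (f : boolfun) : Prop :=
  exists f' : boolfun, strict_minor f' f /\
    forall g : boolfun, strict_minor g f -> minor g f'.

(* Main.v *)
(** Write [f_ij] for [f] with the variable [x_i] replaced by [x_j].  Every strict minor of [f] is a
    minor of some [f_ij] with [x_i], [x_j] essential, and a minor is strict iff it
    has fewer essential variables.  So a lower cover [g] of [f] is equivalent to
    some [f_ij], and any [h] with [g <= h < f] is equivalent to [g].

    Suppose [ess g <= ess f - 2].  If [f_ij] does not depend on both [x_j] and
    [x_k], then identifying these two does not lose anything, so [g] is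
    equivalent to [f (u, u, u, ...)], hence a minor of [f_ik] and [f_jk] as well.
    Either [f_ij] does not depend on [x_j], and this applies to every [k], or
    it does not depend on some other [x_k], and then [x_i], [x_j], [x_k] turn out to be
    the only essential variables.  In this way [g] is equivalent to all [f_ij], so it
    is the greatest strict minor of [f]. *)

Require Import Defs.
From mathcomp Require Import all_boot.

Set Implicit Arguments.
Unset Strict Implicit.
Unset Printing Implicit Defensive.

(** * Assignments and essential variables *)

(** With assignments as functions, renaming variables is plain composition. *)
Definition ev (f : boolfun) (a : 'I_(arity f) -> bool) : bool :=
  f [tuple a i | i < arity f].

Lemma eq_ev f (a b : 'I_(arity f) -> bool) : a =1 b -> ev a = ev b.
Proof. by move=> eq_ab; rewrite /ev (eq_mktuple _ eq_ab). Qed.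

Lemma ev_tnth (f : boolfun) (a : (arity f).-tuple bool) : f a = ev (tnth a).
Proof.
by rewrite /ev; congr (bf_val f _); apply: eq_from_tnth => i; rewrite tnth_mktuple.
Qed.

Definition minor_via (g f : boolfun) (sigma : 'I_(arity f) -> 'I_(arity g)) :=
  forall a : 'I_(arity g) -> bool, ev a = ev (a \o sigma).

Lemma minorP g f : minor g f <-> exists sigma, @minor_via g f sigma.
Proof.
split=> -[s Hs]; exists s => a.
  rewrite {1}/ev Hs; apply: eq_ev => i /=.
  by rewrite tnth_mktuple.
by rewrite ev_tnth Hs.
Qed.

Lemma minor_trans g f h : minor g f -> minor f h -> minor g h.
Proof.
move=> /minorP[s Hs] /minorP[t Ht]; apply/minorP; exists (s \o t) => a.
by rewrite Hs Ht.
Qed.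

Definition ess_vars (f : boolfun) := [set i | @essential f i].

Lemma card_ess_vars f : #|ess_vars f| = ess f.
Proof. by []. Qed.

Lemma inessentialP f i :
  reflect (forall a b : 'I_(arity f) -> bool,
             (forall t, t != i -> a t = b t) -> ev a = ev b)
          (i \notin ess_vars f).
Proof.
rewrite inE; apply: (iffP idP) => [ni a b eq_ab | H].
  apply/eqP; apply: contraNT ni => ne.
  apply/existsP; exists [tuple a t | t < arity f].
  apply/existsP; exists (a i); apply/existsP; exists (b i).
  rewrite !ev_tnth; apply: contraNN ne => /eqP e; apply/eqP; move: e.
  congr (_ = _); apply: eq_ev => t; rewrite !tnth_mktuple.
    by case: eqVneq => // ->.
  by case: eqVneq => [-> //|/eq_ab].
apply/negP => /existsP[a /existsP[x /existsP[y /eqP]]]; apply.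
rewrite !ev_tnth; apply: H => t /negbTE ti.
by rewrite !tnth_mktuple ti.
Qed.

Lemma eq_ev_ess f (a b : 'I_(arity f) -> bool) :
  {in ess_vars f, a =1 b} -> ev a = ev b.
Proof.
move=> eq_ab.
(* Inessential variables are changed one at a time, along a list. *)
have gen (s : seq 'I_(arity f)) : {in s, forall t, t \notin ess_vars f} ->
    forall c, (forall t, t \notin s -> c t = b t) -> ev c = ev b.
  elim: s => [|t s IHs] Hs c eq_cb; first by apply: eq_ev => t; apply: eq_cb.
  transitivity (ev (fun u => if u == t then b u else c u)).
    have /inessentialP Ht := Hs t (mem_head _ _).
    by apply: Ht => u /negbTE ->.
  apply: IHs => [u us|u us]; first by apply: Hs; rewrite inE us orbT.
  case: eqVneq => // ut; apply: eq_cb.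
  by rewrite inE negb_or ut us.
apply: (gen (enum (~: ess_vars f))) => t.
  by rewrite mem_enum inE.
by rewrite mem_enum inE negbK; apply: eq_ab.
Qed.

(** * Minors and essential arity *)

Lemma ess_vars_via g f s : @minor_via g f s -> ess_vars g \subset s @: ess_vars f.
Proof.
move=> Hs; apply/subsetP => k; apply: contraLR => nk.
apply/inessentialP => a b eq_ab; rewrite !Hs; apply: eq_ev_ess => i Ei /=.
by apply: eq_ab; apply: contraNN nk => /eqP <-; apply: imset_f.
Qed.

Lemma ess_via g f s : @minor_via g f s -> ess g <= #|s @: ess_vars f|.
Proof. by move=> /ess_vars_via /subset_leq_card. Qed.

Lemma leq_ess g f : minor g f -> ess g <= ess f.
Proof.
by move=> /minorP[s Hs]; apply: leq_trans (ess_via Hs) (leq_imset_card _ _).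
Qed.

(** The image of the essential variables has at least [ess g] elements, so no two of them can be
    merged. *)
Lemma via_inj g f s : @minor_via g f s -> ess f <= ess g ->
  {in ess_vars f &, injective s}.
Proof.
move=> Hs le; apply/imset_injP; rewrite eqn_leq leq_imset_card.
exact: leq_trans le (ess_via Hs).
Qed.

Lemma inj_via_minor g f s : @minor_via g f s ->
  {in ess_vars f &, injective s} -> minor f g.
Proof.
move=> Hs inj_s; apply/minorP.
pose i0 := Ordinal (arity_gt0 f).
(* The default [i0] is never reached on the image of [ess_vars f]. *)
exists (fun k => odflt i0 [pick i in ess_vars f | s i == k]) => a.
rewrite Hs; apply: eq_ev_ess => i Ei /=.
case: pickP => [j /andP[Ej /eqP eq_s]|/(_ i)] /=; last by rewrite Ei eqxx.
by congr a; apply: inj_s.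
Qed.

Lemma minor_ess_ge g f : minor g f -> ess f <= ess g -> minor f g.
Proof. by move=> /minorP[s Hs] /(via_inj Hs); apply: inj_via_minor. Qed.

Lemma minor_ess_lt g f : minor g f -> ess g < ess f -> strict_minor g f.
Proof. by move=> gf lt; split=> // /leq_ess; rewrite leqNgt lt. Qed.

(** * Identification of two variables *)

Definition subst_vars (f : boolfun) (s : 'I_(arity f) -> 'I_(arity f)) :=
  BoolFun (arity_gt0 f)
    [ffun a => f [tuple tnth a (s i) | i < arity f]].

Definition redirect n (i j t : 'I_n) := if t == i then j else t.

(* The variable [i] becomes a dummy, so that the arity does not change. *)
Definition identify f i j := @subst_vars f (redirect i j).

Lemma ev_subst f s (a : 'I_(arity f) -> bool) :
  @ev (subst_vars s) a = @ev f (a \o s).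
Proof.
by rewrite /ev ffunE; congr (bf_val f _); apply: eq_from_tnth => i; rewrite !tnth_mktuple.
Qed.

Lemma subst_via f s : @minor_via (subst_vars s) f s.
Proof. by move=> a; rewrite ev_subst. Qed.

Lemma identify_minor f i j : minor (@identify f i j) f.
Proof. by apply/minorP; exists (redirect i j); apply: subst_via. Qed.

Lemma eq_subst_minor f (s s' : 'I_(arity f) -> 'I_(arity f)) :
  (forall a : 'I_(arity f) -> bool, ev (a \o s) = ev (a \o s')) ->
  minor (subst_vars s) (subst_vars s').
Proof. by move=> H; apply/minorP; exists id => a; rewrite !ev_subst. Qed.

Lemma subst_comp_via f (s t : 'I_(arity f) -> 'I_(arity f)) :
  @minor_via (subst_vars (t \o s)) (subst_vars s) t.
Proof. by move=> a; rewrite !ev_subst. Qed.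

Lemma ess_identify_lt f (i j : 'I_(arity f)) :
  i \in ess_vars f -> j \in ess_vars f -> i != j -> ess (identify i j) < ess f.
Proof.
move=> Ei Ej ij; rewrite ltnNge; apply/negP.
move=> /(via_inj (@subst_via f (redirect i j)))/(_ i j Ei Ej).
by rewrite /redirect eqxx (negbTE (_ : j != i)) 1?eq_sym // => /(_ erefl) /eqP; apply/negP.
Qed.

Ltac case_vars :=
  repeat match goal with
  | |- context[?a == ?b] => is_var a; is_var b; case: (eqVneq a b) => ?; try subst
  | H : is_true (?a != ?a) |- _ => by rewrite eqxx in H
  end; rewrite //=.

Lemma identifyC_minor f (i j : 'I_(arity f)) : minor (identify i j) (identify j i).
Proof.
apply/minorP; exists (redirect i j) => a; rewrite !ev_subst; apply: eq_ev => t /=.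
by rewrite /redirect; case_vars.
Qed.

(** A renaming injective on [ess_vars f] would give an equivalence, so it merges two essential
    variables and factors through their identification. *)
Lemma strict_minor_identify g f : strict_minor g f ->
  exists i j : 'I_(arity f), [/\ i \in ess_vars f, j \in ess_vars f, i != j
    & minor g (identify i j)].
Proof.
move=> [/minorP[s Hs] nfg].
case: (boolP (dinjectiveb s (mem (ess_vars f)))) => [/dinjectiveP inj|].
  by case: nfg; apply: (inj_via_minor Hs).
case/dinjectivePn=> i Ei [j /andP[ji Ej] eq_s]; exists i, j; split=> //.
  by rewrite eq_sym.
apply/minorP; exists s => a; rewrite ev_subst Hs; apply: eq_ev => t /=.
by rewrite /redirect; case: eqP => // ->; rewrite eq_s.
Qed.

(** * Minors between a lower cover and [f] *)

Lemma lower_cover_ess g f h : lower_cover g f ->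
  minor g h -> minor h f -> ess h < ess f -> ess h = ess g.
Proof.
move=> [_ no_mid] gh hf hlt; apply/eqP; rewrite eq_sym eqn_leq leq_ess //=.
rewrite leqNgt; apply/negP => lt; apply: no_mid.
by exists h; split; apply: minor_ess_lt.
Qed.

(** [identify i j] has only [ess g] essential variables, so a further identification that keeps [g]
    as a minor cannot merge two of them. *)
Lemma lower_cover_redirect g f (i j s t : 'I_(arity f)) : lower_cover g f ->
  i \in ess_vars f -> j \in ess_vars f -> i != j -> s != t ->
  minor g (subst_vars (redirect s t \o redirect i j)) ->
  (s \notin ess_vars (identify i j)) || (t \notin ess_vars (identify i j)).
Proof.
move=> cov Ei Ej ij st gr; rewrite -negb_and; apply/negP => /andP[Es Et].
have via := @subst_comp_via f (redirect i j) (redirect s t).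
have gh : minor g (identify i j).
  by apply: minor_trans gr _; apply/minorP; exists (redirect s t).
have le : ess (identify i j) <= ess (subst_vars (redirect s t \o redirect i j)).
  rewrite (lower_cover_ess cov gh) ?leq_ess //; first exact: identify_minor.
  exact: ess_identify_lt.
have /(_ s t Es Et) := via_inj via le.
by rewrite /redirect eqxx; case: (t =P s) st => [->|_ /eqP st /(_ erefl)]; rewrite ?eqxx.
Qed.

Lemma lower_cover_triple g f (i j k : 'I_(arity f)) : lower_cover g f ->
  i \in ess_vars f -> j \in ess_vars f -> k \in ess_vars f ->
  i != j -> i != k -> j != k -> minor g (identify i j) ->
  (j \notin ess_vars (identify i j)) || (k \notin ess_vars (identify i j)) ->
  [/\ minor g (identify i k), minor g (identify j k),
      (j \notin ess_vars (identify i k)) || (k \notin ess_vars (identify i k)) &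
      (i \notin ess_vars (identify j k)) || (k \notin ess_vars (identify j k))].
Proof.
move=> cov Ei Ej Ek ij ik jk gij njk.
(* [p] merges all three variables, so it also arises from [identify i k] and from [identify j k]. *)
pose p := subst_vars (redirect j k \o redirect i j).
have gp : minor g p.
  apply: minor_trans gij _.
  apply: (inj_via_minor (@subst_comp_via f (redirect i j) (redirect j k))) => s t.
  rewrite -/(identify i j) => Es Et.
  rewrite /redirect; case: (s =P j) (t =P j) => [sj|sj] [tj|tj] //.
  - by rewrite sj tj.
  - by move=> kt; move: njk Es Et; rewrite sj -kt => njk ejj ejk; rewrite ejj ejk in njk.
  - by move=> sk; move: njk Es Et; rewrite tj sk => njk ejk ejj; rewrite ejj ejk in njk.
have gik : minor g (subst_vars (redirect j k \o redirect i k)).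
  apply: minor_trans gp _; apply: eq_subst_minor => a; apply: eq_ev => t /=.
  by rewrite /redirect; case_vars.
have gjk : minor g (subst_vars (redirect i k \o redirect j k)).
  apply: minor_trans gp _; apply: eq_subst_minor => a; apply: eq_ev => t /=.
  by rewrite /redirect; case_vars.
split.
- by apply: minor_trans gik _; apply/minorP; exists (redirect j k); apply: subst_comp_via.
- by apply: minor_trans gjk _; apply/minorP; exists (redirect i k); apply: subst_comp_via.
- exact: lower_cover_redirect gik.
- exact: lower_cover_redirect gjk.
Qed.

(** * Losing a variable other than the identified pair *)

(** [f] and [identify p q] agree where [p] and [q] have equal values. The value at [p] is exempt as
    it follows that at [q]; for [m = q] both change. *)
Lemma inessential_identify f (p q m : 'I_(arity f)) :
  m \notin ess_vars (identify p q) -> p != q ->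
  forall a b : 'I_(arity f) -> bool, a p = a q -> b p = b q ->
  (forall t, t != m -> t != p -> a t = b t) -> ev a = ev b.
Proof.
move=> /inessentialP nm pq a b ap bp eq_ab.
have := nm a (fun t => if t == p then a p else b t); rewrite !ev_subst => e.
transitivity (ev (a \o redirect p q)).
  by apply: eq_ev => t /=; rewrite /redirect; case_vars.
rewrite e => [|t tm]; first by apply: eq_ev => t /=; rewrite /redirect; case_vars.
by case: eqVneq => [-> //|]; apply: eq_ab.
Qed.

Definition set4 n (i j k l : 'I_n) (z : 'I_n -> bool) x y w v t :=
  if t == i then x else if t == j then y else
  if t == k then w else if t == l then v else z t.

(* Two of three Boolean arguments always agree, so the identifications within
   [i], [j], [k] determine [f]: up to the remaining variables it is
   [p (m x_i x_j x_k)], where [m] is a projection, the majority or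
   [maj x_i x_j (~~ x_k)].  A projection would make a variable inessential; in the
   other two cases a further essential [l] gives an identification with [l] that
   still has [p] as a minor and hence cannot have more essential variables than
   [p], which forces some variable of [f] to be inessential. *)
Lemma lower_cover_ess_vars3 g f (i j k l : 'I_(arity f)) :
  lower_cover g f ->
  i \in ess_vars f -> j \in ess_vars f -> k \in ess_vars f -> l \in ess_vars f ->
  i != j -> i != k -> j != k -> minor g (identify i j) ->
  k \notin ess_vars (identify i j) -> l \in [:: i; j; k].
Proof.
move=> cov Ei Ej Ek El ij ik jk gij nk.
rewrite !inE -(negbK (_ || _)) !negb_or; apply/negP => /and3P[li lj lk].
(* [f] as a function of four bits, with [z] fixing the other variables. *)
pose G z x y w v := ev (set4 i j k l z x y w v).
have evG a b : (forall t, t \notin [:: i; j; k; l] -> a t = b t) ->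
    ev b = G a (b i) (b j) (b k) (b l).
  move=> eq_ab; apply: eq_ev => t; have := eq_ab t.
  by rewrite /set4 !inE; case_vars => ->.
have noG m : m \in ess_vars f -> m \in [:: i; j; k; l] ->
    (forall a b, (forall t, t != m -> a t = b t) ->
       G a (a i) (a j) (a k) (a l) = G a (b i) (b j) (b k) (b l)) -> False.
  move=> Em mijkl H; suff /negP: m \notin ess_vars f by apply.
  apply/inessentialP => a b eq_ab; rewrite (evG a a) // (evG a b); first exact: H.
  move=> t tijkl.
  by apply: eq_ab; apply: contraNneq tijkl => ->.
have noi : ~ forall z x x' y w v, G z x y w v = G z x' y w v.
  move=> H; apply: (noG i) => //; rewrite ?inE ?eqxx // => a b e.
  by rewrite -!(e j, e k, e l) // 1?eq_sym.
have noj : ~ forall z x y y' w v, G z x y w v = G z x y' w v.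
  move=> H; apply: (noG j) => //; rewrite ?inE ?eqxx ?orbT // => a b e.
  by rewrite -!(e i, e k, e l) // 1?eq_sym.
have nol : ~ forall z x y w v v', G z x y w v = G z x y w v'.
  move=> H; apply: (noG l) => //; rewrite ?inE ?eqxx ?orbT // => a b e.
  by rewrite -!(e i, e j, e k) // 1?eq_sym.
have [|gik gjk nik njk] := lower_cover_triple cov Ei Ej Ek ij ik jk gij.
  by rewrite nk orbT.
have G1 z x w v : G z x x w v = G z x x x v.
  by apply: (inessential_identify nk) => // *; rewrite /set4; case_vars.
(* By [G1], [identify i j] is the diagonal where [x_i], [x_j], [x_k] all equal [x_j]; a renaming
   that yields this diagonal keeps [g] as a minor. *)
have gsub (s : 'I_(arity f) -> 'I_(arity f)) :
    (forall t, t \notin [:: i; j; k; l] -> s t = t) -> 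
    (forall a, G a (a j) (a j) (a j) (a l) =
               G a (a (s i)) (a (s j)) (a (s k)) (a (s l))) ->
    minor g (subst_vars s).
  move=> sid H; apply: minor_trans gij _; apply: eq_subst_minor => a.
  rewrite (evG a (a \o s)) /=; last by move=> t /sid ->.
  rewrite -H (evG a (a \o _)) /= /redirect.
    by rewrite eqxx !ifN // 1?eq_sym //.
  by move=> t; rewrite !inE; case_vars.
case/orP: nik => nik; case/orP: njk => njk.
(* Majority. *)
- have G2 z x y v : G z x y x v = G z x x x v.
    by apply: (inessential_identify nik) => // *; rewrite /set4; case_vars.
  have G3 z x y v : G z x y y v = G z y y y v.
    by apply: (inessential_identify njk) => // *; rewrite /set4; case_vars.
  (* If the diagonal ignores the merged bit, then [f] ignores [x_i]. *)
  suff Gp z v : G z (~~ v) (~~ v) (~~ v) v = G z v v v v.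
    by apply: noi => z x x' y w v; move: v x x' y w (Gp z v) => [] [] [] [] [] /=; congruence.
  (* With [x_i := x_l] and [x_k := x_j] the majority is [x_j]. *)
  have /orP[nil|nil] :
      (k \notin ess_vars (identify i l)) || (j \notin ess_vars (identify i l)).
    apply: (lower_cover_redirect cov) => //; rewrite 1?eq_sym //.
    apply: gsub => [t|a] /=; first by rewrite /redirect !inE; case_vars.
    by rewrite /redirect; case_vars.
  + have G4 y w : G z v y w v = G z v y y v.
      by apply: (inessential_identify nil); rewrite 1?eq_sym // => *; rewrite /set4; case_vars.
    by rewrite -(G3 z v) -(G2 z v (~~ v)) (G4 _ v).
  + have G4 y w : G z v y w v = G z v w w v.
      by apply: (inessential_identify nil); rewrite 1?eq_sym // => *; rewrite /set4; case_vars.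
    by rewrite -(G3 z v) -(G1 z v (~~ v)) (G4 v).
(* Projection to [x_i]. *)
- have G2 z x y v : G z x y x v = G z x x x v.
    by apply: (inessential_identify nik) => // *; rewrite /set4; case_vars.
  have G3 z x y v : G z x y y v = G z x x x v.
    by apply: (inessential_identify njk) => // *; rewrite /set4; case_vars.
  by apply: noj => z x y y' w v; move: x y y' w => [] [] [] []; congruence.
(* Projection to [x_j]. *)
- have G2 z x y v : G z x y x v = G z y y y v.
    by apply: (inessential_identify nik) => // *; rewrite /set4; case_vars.
  have G3 z x y v : G z x y y v = G z y y y v.
    by apply: (inessential_identify njk) => // *; rewrite /set4; case_vars.
  by apply: noi => z x x' y w v; move: x x' y w => [] [] [] []; congruence.
(* The case [maj x_i x_j (~~ x_k)]. *)
have G2 z x y v : G z x y x v = G z y y y v.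
  by apply: (inessential_identify nik) => // *; rewrite /set4; case_vars.
have G3 z x y v : G z x y y v = G z x x x v.
  by apply: (inessential_identify njk) => // *; rewrite /set4; case_vars.
(* With [x_i] and [x_k] both set to [x_l], the value [maj x_l x_j (~~ x_l)] is [x_j]. *)
have : (i \notin ess_vars (identify k l)) || (l \notin ess_vars (identify k l)).
  apply: (lower_cover_redirect cov); rewrite 1?eq_sym //.
  apply: gsub => [t|a] /=; first by rewrite /redirect !inE; case_vars.
  by rewrite /redirect; case_vars.
have [nl _|_] := boolP (l \notin ess_vars (identify k l)).
  have G4 z u v v' : G z u u v v = G z u u v' v'.
    by apply: (inessential_identify nl); rewrite 1?eq_sym // => *; rewrite /set4; case_vars.
  have Gp z u v : G z u u u v = G z u u u true.
    by rewrite -(G1 z u v) -(G1 z u true) (G4 z u v true).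
  by apply: nol => z x y w v v'; move: x y w => [] [] []; congruence.
rewrite orbF => ni.
have G4 z x y v : G z x y v v = G z y y v v.
  by apply: (inessential_identify ni); rewrite 1?eq_sym // => *; rewrite /set4; case_vars.
have Gp z v : G z (~~ v) (~~ v) (~~ v) v = G z v v v v by rewrite -(G3 z _ v) G4.
by apply: noi => z x x' y w v; move: v x x' y w (Gp z v) => [] [] [] [] [] /=; congruence.
Qed.

(** * Lower covers that lose at least two variables *)

Lemma lower_cover_identify_step g f (i j k : 'I_(arity f)) :
  lower_cover g f -> ess g + 2 <= ess f ->
  i \in ess_vars f -> j \in ess_vars f -> k \in ess_vars f ->
  i != j -> i != k -> j != k -> minor g (identify i j) ->
  minor g (identify i k) /\ minor g (identify j k).
Proof.
move=> cov le2 Ei Ej Ek ij ik jk gij.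
have [njk|] := boolP ((j \notin ess_vars (identify i j)) || (k \notin ess_vars (identify i j))).
  by have [] := lower_cover_triple cov Ei Ej Ek ij ik jk gij njk.
rewrite negb_or !negbK => /andP[ej ek].
(* By counting, some essential [x_m] besides [x_i] is lost; the three-variable lemma then forces
   [k = m], against [ek]. *)
have : ~~ (ess_vars f :\ i \subset ess_vars (identify i j)).
  apply/negP => /subset_leq_card le.
  have {le} : #|ess_vars f :\ i| <= ess g.
    by rewrite -(lower_cover_ess cov gij (identify_minor _ _) (ess_identify_lt Ei Ej ij)).
  move: le2; rewrite -[ess f]card_ess_vars (cardsD1 i) Ei addn2 add1n ltnS => lt.
  by rewrite leqNgt lt.
case/subsetPn=> m; rewrite in_setD1 => /andP[mi Em] nm.
have mj : m != j by apply: contraNneq nm => ->.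
have : k \in [:: i; j; m].
  by apply: (lower_cover_ess_vars3 cov Ei Ej Em Ek ij _ _ gij nm); rewrite eq_sym.
rewrite !inE eq_sym (negbTE ik) eq_sym (negbTE jk) /= => /eqP km.
by rewrite -km ek in nm.
Qed.

(** Starting from one pair [i], [j], a first step reaches all pairs containing [i], a second one all
    pairs. *)
Lemma lower_cover_identify g f (s t : 'I_(arity f)) :
  lower_cover g f -> ess g + 2 <= ess f ->
  s \in ess_vars f -> t \in ess_vars f -> s != t -> minor g (identify s t).
Proof.
move=> cov le2 Es Et st.
have [i [j [Ei Ej ij gij]]] := strict_minor_identify cov.1.
have step i' j' k := @lower_cover_identify_step g f i' j' k cov le2.
have sym p q : minor g (identify p q) -> minor g (identify q p).
  by move=> gpq; apply: minor_trans gpq (identifyC_minor _ _).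
have git u : u \in ess_vars f -> u != i -> minor g (identify i u).
  move=> Eu ui; case: (eqVneq u j) => [-> //|uj].
  by have [] := step i j u Ei Ej Eu ij; rewrite 1?eq_sym.
case: (eqVneq s i) => [si|si]; first by rewrite si; apply: git; rewrite // -si eq_sym.
case: (eqVneq t i) => [ti|ti]; first by rewrite ti; apply: sym; apply: git.
by have [] := step i s t Ei Es Et _ _ st (git s Es si); rewrite 1?eq_sym.
Qed.

Lemma ess0_identify_const f (p q : 'I_(arity f)) (a : 'I_(arity f) -> bool) :
  ess (identify p q) = 0 -> a p = a q -> ev a = ev (fun _ : 'I_(arity f) => false).
Proof.
move=> /eqP e0 apq; transitivity (@ev (identify p q) a).
  by rewrite ev_subst; apply: eq_ev => t /=; rewrite /redirect; case_vars.
rewrite (@eq_ev_ess (identify p q) a (fun=> false)) ?ev_subst // => t.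
by move: e0; rewrite -card_ess_vars cards_eq0 => /eqP ->; rewrite inE.
Qed.

(** If [identify i j] loses at most [x_i] and [x_j], counting suffices. Otherwise [f] has at most
    three essential variables, and [ess g = 0] must be excluded. *)
Lemma lower_cover_ess2 g f : lower_cover g f -> ess g + 2 <= ess f -> ess g + 2 = ess f.
Proof.
move=> cov le2; apply/eqP; rewrite eqn_leq le2 /=.
have [i [j [Ei Ej ij gij]]] := strict_minor_identify cov.1.
have essE p q : p \in ess_vars f -> q \in ess_vars f -> p != q -> ess (identify p q) = ess g.
  move=> Ep Eq pq; apply: (lower_cover_ess cov); last exact: ess_identify_lt.
    exact: lower_cover_identify.
  exact: identify_minor.
have [|] := boolP (ess_vars f :\ i :\ j \subset ess_vars (identify i j)).
  move=> /subset_leq_card le.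
  have {}le : #|ess_vars f :\ i :\ j| <= ess g by rewrite -(essE i j).
  rewrite -[ess f]card_ess_vars (cardsD1 i) Ei (cardsD1 j) in_setD1 Ej eq_sym ij.
  by rewrite addn2 !add1n !ltnS.
case/subsetPn=> k; rewrite !in_setD1 => /and3P[kj ki Ek] nk.
have E3 : ess f <= 3.
  rewrite -card_ess_vars; apply: leq_trans (card_size [:: i; j; k]).
  apply: subset_leq_card; apply/subsetP => l El.
  by apply: (lower_cover_ess_vars3 cov Ei Ej Ek El ij _ _ gij nk); rewrite eq_sym.
case: (posnP (ess g)) => [e0|pos]; last by apply: leq_trans E3 _; rewrite addn2.
suff /negP[] : i \notin ess_vars f by [].
apply/inessentialP => a b _.
suff const (c : 'I_(arity f) -> bool) : ev c = ev (fun _ : 'I_(arity f) => false) by rewrite !const.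
(* Two of three bits agree, and all three identifications are constant. *)
have: [|| c i == c j, c i == c k | c j == c k] by case: (c i) (c j) (c k) => [] [] [].
by case/or3P=> /eqP; apply: ess0_identify_const; rewrite essE // eq_sym.
Qed.

Lemma lower_cover_greatest g f h :
  lower_cover g f -> ess g + 2 <= ess f -> strict_minor h f -> minor h g.
Proof.
move=> cov le2 /strict_minor_identify[i [j [Ei Ej ij hij]]].
have gij := lower_cover_identify cov le2 Ei Ej ij.
apply: (minor_trans hij); apply: (minor_ess_ge gij).
by rewrite (lower_cover_ess cov gij (identify_minor _ _) (ess_identify_lt Ei Ej ij)).
Qed.

Lemma strict_minor_ess g f : strict_minor g f -> ess g < ess f.
Proof.
move=> /strict_minor_identify[i [j [Ei Ej ij /leq_ess le]]].
exact: leq_ltn_trans le (ess_identify_lt Ei Ej ij).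
Qed.

Theorem theorem2p9 (f : boolfun) :
  (forall g h : boolfun,
     lower_cover g f -> lower_cover h f -> ess g = ess h) /\
  (forall g : boolfun, lower_cover g f ->
     ess g + 1 = ess f \/ ess g + 2 = ess f) /\
  (forall g : boolfun, lower_cover g f ->
     ess g + 2 = ess f -> join_irreducible f).
Proof.
have dich g : lower_cover g f -> ess g + 1 = ess f \/ ess g + 2 = ess f.
  move=> cov; have := strict_minor_ess cov.1.
  rewrite leq_eqVlt => /orP[/eqP <-|lt]; first by rewrite addn1; left.
  by right; apply: lower_cover_ess2 => //; rewrite addn2.
(* Here [g] is the greatest strict minor, so [h <= g < f]. *)
have same g h : lower_cover g f -> lower_cover h f -> ess g + 2 = ess f -> ess g = ess h.
  move=> covg covh e2; apply: (lower_cover_ess covh); first 1 last.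
  - exact: covg.1.1.
  - exact: strict_minor_ess covg.1.
  - by apply: lower_cover_greatest covh.1; rewrite // e2.
split; [move=> g h covg covh | split=> // g covg e2].
  case: (dich g covg) (dich h covh) => [eg|eg] [eh|eh]; last exact: same.
  - by apply/eqP; rewrite -(eqn_add2r 1) eg eh.
  - by apply/esym/same.
  - exact: same.
exists g; split; first exact: covg.1.
by move=> h; apply: lower_cover_greatest; rewrite ?e2.
Qed.
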